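(* Let $q$ be a prime power with $q\equiv 3\pmod 4$, and suppose there are infinitely many primes $p$ with $p\equiv 3\pmod 4$, $\gcd(p,q)=1$, $\mathrm{ord}_{4p}(q)=p-1$ and $\mathrm{ord}_p(q)\equiv 2\pmod 4$ (this holds, e.g., if infinitely many primes $p\equiv 3 \pmod 4$ have $q$ as a primitive root). For such $p$ put $n=2p$. Then: (1) there is an infinite family of self-dual double-negacirculant codes $C_h$ over $\mathbb{F}_q$, of lengths $2n$ (with $n=2p$, $p$ ranging over such primes), whose relative distance $\delta$ satisfies $H_q(\delta)\ge \frac18$; (2) there is an infinite family of self-dual four-negacirculant codes $C_{a,b}$ over $\mathbb{F}_q$, of lengths $4n$, whose relative distance $\delta$ satisfies $H_q(\delta)\ge\frac1{16}$.
   Context: $R=\mathbb{F}_q[x]/\langle x^n+1\rangle$. For $a=\sum a_ix^i\in R$, its negacirculant matrix is the $n\times n$ matrix with first row $(a_0,\dots,a_{n-1})$, each subsequent row being the negashift $(x_0,\dots,x_{n-1})\mapsto(-x_{n-1},x_0,\dots,x_{n-2})$ of the previous one. A double-negacirculant code $C_h$ ($h\in R$, matrix $H$) is the code of length $2n$ generated by $(I_n\ H)$; a four-negacirculant code $C_{a,b}$ ($a,b\in R$, matrices $A,B$) is the code of length $4n$ generated by $\begin{pmatrix} I_n & 0 & A & B\\ 0 & I_n & -B^t & A^t\end{pmatrix}$. Self-duality is with respect to the Euclidean inner product. For a family of codes of lengths $N\to\infty$ and minimum distances $d_N$, the relative distance is $\delta=\liminf d_N/N$. The $q$-ary entropy function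 is $H_q(t)=t\log_q(q-1)-t\log_q t-(1-t)\log_q(1-t)$ for $0<t<\frac{q-1}{q}$ and $H_q(0)=0$. $\mathrm{ord}_m(q)$ is the multiplicative order of $q$ modulo $m$. *)

(* Defs.v *)
From Stdlib Require Import Reals.
From HB Require Import structures.
From mathcomp Require Import all_boot all_order all_algebra all_field.
Set Implicit Arguments. Unset Strict Implicit. Unset Printing Implicit Defensive.
Import GRing.Theory.

(* multiplicative order of a modulo m: least k >= 1 with a^k = 1 (mod m);
   searched among 1..m (this suffices whenever a is a unit mod m, since the
   order then is at most totient m <= m); 0 if not found. *)
Definition ord_mod (m a : nat) : nat :=
  let k := find (fun k => a ^ k.+1 == 1 %[mod m]) (iota 0 m) in
  if k < m then k.+1 else 0.

Definition admissible_prime (q p : nat) : Prop :=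
  [/\ prime p, p %% 4 = 3, coprime p q, ord_mod (4 * p) q = p.-1
    & ord_mod p q %% 4 = 2].

Local Open Scope ring_scope.

(* The ring R = F[x]/<x^n+1>: an element is represented by a polynomial
   a : {poly F}, its canonical representative being a %% ('X^n + 1). *)
(* negacirculant n x n matrix of a : first row (a_0,...,a_{n-1}), each
   following row the negashift of the previous one; entry (i,j) is a_{j-i}
   if i <= j and -a_{n+j-i} otherwise. *)
Definition negacirc (F : fieldType) (n : nat) (a : {poly F}) : 'M[F]_n :=
  let r := a %% ('X^n + 1) in
  \matrix_(i < n, j < n)
     (if (i <= j)%N then r`_(j - i) else - r`_(n + j - i)).

Definition gen_code (F : finFieldType) (k N : nat) (G : 'M[F]_(k, N))
  : {set 'rV[F]_N} := [set x : 'rV[F]_N | (x <= G)%MS].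

Definition dual_code (F : finFieldType) (N : nat) (C : {set 'rV[F]_N})
  : {set 'rV[F]_N} := [set y : 'rV[F]_N | [forall x in C, x *m y^T == 0]].

Definition self_dual (F : finFieldType) (N : nat) (C : {set 'rV[F]_N}) :=
  C = dual_code C.

(* Hamming weight and minimum distance (min weight of a nonzero codeword;
   N by convention for the zero code) *)
Definition wt (F : fieldType) (N : nat) (x : 'rV[F]_N) : nat :=
  #|[set i : 'I_N | x 0 i != 0]|.

Definition min_dist (F : finFieldType) (N : nat) (C : {set 'rV[F]_N}) : nat :=
  \big[minn/N]_(x in C | x != 0) wt x.

Definition double_negacirc_code (F : finFieldType) (n : nat) (h : {poly F})
  : {set 'rV[F]_(n + n)} := gen_code (row_mx 1%:M (negacirc n h)).

Definition four_negacirc_code (F : finFieldType) (n : nat) (a b : {poly F})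
  : {set 'rV[F]_((n + n) + (n + n))} :=
  let A := negacirc n a in let B := negacirc n b in
  gen_code (row_mx (block_mx 1%:M 0 0 1%:M) (block_mx A B (- B^T) A^T)).

Local Close Scope ring_scope.

Local Open Scope R_scope.

Definition Rfrac (a b : nat) : R := INR a / INR b.

Definition logb (q : nat) (x : R) : R := ln x / ln (INR q).

(* q-ary entropy function; used on 0 <= t < (q-1)/q *)
Definition Hq (q : nat) (t : R) : R :=
  if Req_EM_T t 0 then 0 else
  t * logb q (INR q - 1) - t * logb q t - (1 - t) * logb q (1 - t).

Definition is_liminf (u : nat -> R) (l : R) : Prop :=
  forall eps, 0 < eps ->
    (exists K, forall k, (K <= k)%nat -> l - eps < u k) /\
    (forall K, exists k, (K <= k)%nat /\ u k < l + eps).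

Local Close Scope R_scope.

(* Main.v *)
(* Put n = 2p and z = - x^2.  Then z^p = 1 in R = F[x]/(x^n + 1), and
   z^p - 1 = (z - 1) Phi(z) with Phi irreducible, because the order condition on
   q makes q a primitive root modulo p.  Transposing negacirculant matrices
   corresponds to x |-> 1/x.  If a^2 + b^2 = -1 in F, then a + b x^p has norm -1,
   while (1 + s + t)/(1 + s - t) has norm 1 when t = z - 1/z and s is a
   combination of the z^i + z^(-i) - 2, 1 <= i <= (p-1)/2.  The products h
   give q^((p-1)/2) self-dual codes C_h.  A word (u, v) in two of them satisfies
   2 t (s' - s) u = 0; as t and s' - s are invertible modulo Phi, this gives
   z u = u, so that u = 0 or u has weight at least p.  By pigeonhole some C_h has
   a minimum distance d such that the ball of radius d in F^(4p) contains
   q^((p-1)/2) words.  Bounding the ball by (1 + (q-1) x)^(4p) / x^d for every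
   x in (0, 1] gives an inequality which is affine in d/(4p), hence passes to the
   lower limit; optimizing x afterwards yields H_q(delta) >= 1/8.

   The code C_(h,0) is a direct sum of two codes equivalent to C_h: it has the
   same minimum distance and twice the length, and the same argument gives
   H_q(delta) >= 1/16. *)

Require Import Defs.
From Stdlib Require Import Reals Lra ClassicalChoice.
From Coquelicot Require Rcomplements Lim_seq.
From HB Require Import structures.
From mathcomp Require Import all_boot all_order all_algebra all_field.
From mathcomp Require Import fingroup pgroup abelian zify.
Set Implicit Arguments. Unset Strict Implicit. Unset Printing Implicit Defensive.
Import Order.TTheory GRing.Theory Num.Theory.

(** * Lower limits and the entropy function *)

Local Open Scope R_scope.

Lemma is_liminf_exists (u : nat -> R) (A : R) :
  (forall k, 0 <= u k <= A) -> exists delta, is_liminf u delta.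
Proof.
intros u_bnd; destruct (Lim_seq.ex_LimInf_seq u) as [[l | | ] Hl].
- exists l; intros eps eps_gt0; destruct (Hl (mkposreal eps eps_gt0)) as [Hsup Hinf].
  split.
    destruct Hinf as [K HK]; exists K; intros k K_le; apply HK; exact/ssrnat.leP.
  intros K; destruct (Hsup K) as [k [K_le uk]]; exists k.
  split; [exact/ssrnat.leP | exact uk].
(* The bounds on [u] exclude an infinite lower limit. *)
- destruct (Hl A) as [K HK]; specialize (HK K (le_n K)).
  specialize (u_bnd K); lra.
- destruct (Hl 0 O) as [k [_ Hk]]; specialize (u_bnd k); lra.
Qed.

Lemma ln_1p_le (y : R) : 0 <= y -> ln (1 + y) <= y.
Proof.
intros y_ge0; rewrite -{2}(ln_exp y).
destruct (Req_dec y 0) as [-> | y_neq0].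
  rewrite exp_0 Rplus_0_r; lra.
left; apply ln_increasing; [lra | apply exp_ineq1; lra].
Qed.

Section Entropy.
Variable q : nat.
Hypothesis q_ge2 : 2 <= INR q.

Lemma ln_INR_gt0 : 0 < ln (INR q).
Proof. rewrite -ln_1; apply ln_increasing; lra. Qed.

Lemma logb_le0 (x : R) : 0 < x <= 1 -> logb q x <= 0.
Proof.
intros [x_gt0 x_le1]; unfold logb.
assert (ln x <= 0).
  destruct (Req_dec x 1) as [-> | x_neq1]; [rewrite ln_1; lra|].
  left; rewrite -ln_1; apply ln_increasing; lra.
apply Rmult_le_reg_r with (ln (INR q)); [exact ln_INR_gt0|].
unfold Rdiv; rewrite Rmult_assoc Rinv_l ?Rmult_0_l; pose proof ln_INR_gt0; lra.
Qed.

(* [Hq q delta] is the value of the right-hand side at its minimum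
   [x = delta / ((q - 1) (1 - delta))]. *)
Lemma Hq_ge (c delta : R) : 0 < c -> 0 <= delta <= / 2 ->
  (forall x, 0 < x <= 1 ->
     c <= logb q (1 + (INR q - 1) * x) - delta * logb q x) ->
  Hq q delta >= c.
Proof.
intros c_gt0 [delta_ge0 delta_le] chernoff.
pose proof ln_INR_gt0 as lnq_gt0.
unfold Hq; destruct (Req_EM_T delta 0) as [delta0 | delta_neq0].
  (* At [delta = 0] the hypothesis fails as [x] tends to 0: [y] stands for [(q - 1) x] and is chosen
     so that [ln (1 + y) <= y <= c ln q / 2]. *)
  exfalso; subst delta.
  set (y := Rmin 1 (c * ln (INR q) / 2)).
  assert (y_gt0 : 0 < y) by (apply Rmin_pos; nra).
  assert (y_le1 : y <= 1) by apply Rmin_l.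
  assert (y_le : y <= c * ln (INR q) / 2) by apply Rmin_r.
  assert (x_bnd : 0 < y / (INR q - 1) <= 1).
    split; [apply Rdiv_lt_0_compat; lra|].
    apply Rmult_le_reg_r with (INR q - 1); [lra|].
    unfold Rdiv; rewrite Rmult_assoc Rinv_l; lra.
  specialize (chernoff _ x_bnd).
  replace ((INR q - 1) * (y / (INR q - 1))) with y in chernoff by (field; lra).
  pose proof (ln_1p_le (Rlt_le _ _ y_gt0)) as ln_y.
  unfold logb in chernoff.
  assert (ln (1 + y) / ln (INR q) <= c / 2).
    apply Rmult_le_reg_r with (ln (INR q)); [lra|].
    unfold Rdiv; rewrite Rmult_assoc Rinv_l; lra.
  lra.
set (x := delta / ((INR q - 1) * (1 - delta))).
(* The minimizer is at most 1 because [delta <= 1 - delta] and [q - 1 >= 1]. *)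
assert (x_bnd : 0 < x <= 1).
  split; [apply Rdiv_lt_0_compat; nra|].
  apply Rmult_le_reg_r with ((INR q - 1) * (1 - delta)); [nra|].
  unfold x, Rdiv; rewrite Rmult_assoc Rinv_l; nra.
specialize (chernoff x x_bnd).
replace (1 + (INR q - 1) * x) with (/ (1 - delta)) in chernoff
  by (unfold x; field; lra).
unfold logb in chernoff; rewrite ln_Rinv in chernoff; [|lra].
replace (ln x) with (ln delta - ln (INR q - 1) - ln (1 - delta)) in chernoff.
  unfold logb; apply Rle_ge; apply (Rle_trans _ _ _ chernoff); right.
  rewrite /=; field; lra.
unfold x, Rdiv; rewrite ln_mult ?ln_Rinv ?ln_mult; try lra; try nra.
apply Rinv_0_lt_compat; nra.
Qed.

(** For fixed [x] the inequality is affine in [u k], so it passes to the lower limit along indices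
    with [u k] near [delta]; [e] is a vanishing error. *)
Lemma liminf_entropy (c : R) (u e : nat -> R) : 0 < c ->
  (forall eps, 0 < eps -> exists K, forall k, (K <= k)%N -> e k < eps) ->
  (forall k, e k <= 1) ->
  (forall k, 0 <= u k <= / 2 + e k) ->
  (forall k x, 0 < x <= 1 ->
     c - e k <= logb q (1 + (INR q - 1) * x) - u k * logb q x) ->
  exists delta, is_liminf u delta /\ 0 <= delta <= / 2 /\ Hq q delta >= c.
Proof.
intros c_gt0 e_lim e_le1 u_bnd chernoff.
destruct (@is_liminf_exists u (/ 2 + 1)) as [delta delta_lim].
  intros k; specialize (u_bnd k); specialize (e_le1 k); lra.
assert (near_delta : forall eps, 0 < eps ->
    exists k, delta - eps < u k < delta + eps /\ e k < eps).
  intros eps eps_gt0.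
  destruct (delta_lim eps eps_gt0) as [[K HK] Hsup].
  destruct (e_lim eps eps_gt0) as [K' HK'].
  destruct (Hsup (maxn K K')) as [k [k_ge uk]]; exists k.
  rewrite geq_max in k_ge; move/andP: k_ge => [K_le K'_le].
  repeat split; [exact: HK | exact: uk | exact: HK'].
assert (delta_bnd : 0 <= delta <= / 2).
  split; apply Rnot_lt_le; intros lt_delta.
    destruct (near_delta (- delta)) as [k [[_ uk] _]]; [lra|].
    specialize (u_bnd k); lra.
  destruct (near_delta ((delta - / 2) / 2)) as [k [[uk _] ek]]; [lra|].
  specialize (u_bnd k); lra.
exists delta; split; [exact delta_lim | split; [exact delta_bnd |]].
apply Hq_ge; [exact c_gt0 | exact delta_bnd |]; intros x x_bnd.
pose proof (logb_le0 x_bnd) as l_le0.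
apply Rnot_lt_le; intros gap.
set (l := logb q x) in *; set (L := logb q (1 + (INR q - 1) * x)) in *.
(* An error [eps] in [u k] costs at most [- eps l] and [e k] at most [eps]; this choice makes their
   sum half the gap. *)
destruct (near_delta ((c - (L - delta * l)) / (1 - l) / 2)) as [k [[_ uk] ek]].
  apply Rdiv_lt_0_compat; [apply Rdiv_lt_0_compat|]; lra.
specialize (chernoff k x x_bnd); fold L l in chernoff.
set (eps := (c - (L - delta * l)) / (1 - l) / 2) in *.
assert (eps * (1 - l) = (c - (L - delta * l)) / 2) by (unfold eps; field; lra).
nra.
Qed.

End Entropy.

Section FamilyEntropy.
Variables (q s : nat) (p d : nat -> nat).
Hypotheses (q_ge3 : (3 <= q)%N) (s_gt0 : (0 < s)%N).
Hypotheses (p_gt : forall k, (k < p k)%N) (p_odd : forall k, odd (p k)).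
Hypothesis d_le : forall k, (d k <= (s * p k).+1)%N.
Hypothesis d_chernoff : forall k x, 0 < x <= 1 ->
  INR (p k)./2 * ln (INR q) + INR (d k) * ln x
    <= INR (s * (2 * p k)) * ln (1 + (INR q - 1) * x).

(** The constant comes from [(p - 1) / 2] divided by the length [2 s p], which is
    [1/(4s) - 1/(4sp)]. As [p k > k], the error [1/(k + 1)] absorbs both this defect and the excess
    [1/(2sp)] of the relative distance over 1/2. The two families use [s = 2] and [s = 4]. *)
Lemma family_entropy : exists delta,
  [/\ is_liminf (fun k => Rfrac (d k) (s * (2 * p k))) delta,
      0 <= delta, delta < Rfrac (q - 1) q & Hq q delta >= Rfrac 1 (4 * s)].
Proof.
have q3 : 3 <= INR q by have /ssrnat.leP/le_INR := q_ge3; rewrite /=; lra.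
have q2 : 2 <= INR q by lra.
have s1 : 1 <= INR s by apply: (le_INR 1); apply/ssrnat.leP.
have lnq_gt0 : 0 < ln (INR q) by apply: ln_INR_gt0; lra.
have pk k : INR k.+1 <= INR (p k) by apply: le_INR; apply/ssrnat.leP.
have k1 k : 0 < INR k.+1 by apply: lt_0_INR; apply/ssrnat.ltP.
have lenE k : INR (s * (2 * p k)) = INR s * (2 * INR (p k)).
  by rewrite -!multE !mult_INR.
have halfE k : INR (p k)./2 = (INR (p k) - 1) / 2.
  have {2}-> : p k = ((p k)./2 + (p k)./2).+1 by have := p_odd k; lia.
  by rewrite S_INR -plusE plus_INR; field.
have cE : Rfrac 1 (4 * s) = / (4 * INR s).
  by rewrite /Rfrac -multE mult_INR /=; field; lra.
have [||||| delta [delta_lim [delta_bnd delta_H]]] :=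
  @liminf_entropy q q2 (Rfrac 1 (4 * s)) (fun k => Rfrac (d k) (s * (2 * p k)))
    (fun k => / INR k.+1).
- rewrite cE; apply: Rinv_0_lt_compat; lra.
- move=> eps eps_gt0; have [K [K_eps K_gt0]] := archimed_cor1 eps eps_gt0.
  exists K => k /ssrnat.leP/le_INR le_Kk; apply: Rle_lt_trans K_eps.
  have K0 := lt_0_INR _ K_gt0.
  by apply: Rinv_le_contravar => //; rewrite S_INR; lra.
- move=> k; rewrite -[1]Rinv_1; apply: Rinv_le_contravar; first lra.
  by rewrite S_INR; have := pos_INR k; lra.
- move=> k; have := pk k; have := k1 k => k_gt0 le_p.
  rewrite /Rfrac lenE; split.
    apply: Rmult_le_pos; first exact: pos_INR.
    by left; apply: Rinv_0_lt_compat; nra.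
  have /ssrnat.leP/le_INR := d_le k; rewrite S_INR -multE mult_INR => le_d.
  have inv_p : / INR (p k) <= / INR k.+1 by apply: Rinv_le_contravar.
  apply: (Rle_trans _ ((INR s * INR (p k) + 1) / (INR s * (2 * INR (p k))))).
    by apply: Rmult_le_compat_r => //; left; apply: Rinv_0_lt_compat; nra.
  have -> : (INR s * INR (p k) + 1) / (INR s * (2 * INR (p k)))
          = / 2 + / (2 * INR s) * / INR (p k) by field; lra.
  have : / (2 * INR s) <= 1 by rewrite -[1]Rinv_1; apply: Rinv_le_contravar; lra.
  have : 0 < / INR (p k) by apply: Rinv_0_lt_compat; lra.
  nra.
- move=> k x x_bnd; have := pk k; have := k1 k => k_gt0 le_p.
  have := d_chernoff k x_bnd; rewrite lenE halfE cE /Rfrac lenE /logb => bound.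
  set len := INR s * (2 * INR (p k)) in bound *.
  have len_gt0 : 0 < len by rewrite /len; nra.
  apply: (Rle_trans _ ((INR (p k) - 1) / 2 / len)).
    have -> : (INR (p k) - 1) / 2 / len = / (4 * INR s) - / (4 * INR s) * / INR (p k).
      by rewrite /len; field; lra.
    have : / (4 * INR s) <= 1 by rewrite -[1]Rinv_1; apply: Rinv_le_contravar; lra.
    have : / INR (p k) <= / INR k.+1 by apply: Rinv_le_contravar.
    have : 0 < / INR (p k) by apply: Rinv_0_lt_compat; lra.
    nra.
  apply: (Rmult_le_reg_r (len * ln (INR q))); first exact: Rmult_lt_0_compat.
  have -> : (INR (p k) - 1) / 2 / len * (len * ln (INR q))
          = (INR (p k) - 1) / 2 * ln (INR q) by field; lra.
  set L := ln (1 + _) in bound *.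
  have -> : (L / ln (INR q) - INR (d k) / len * (ln x / ln (INR q))) * (len * ln (INR q))
          = len * L - INR (d k) * ln x by field; lra.
  lra.
exists delta; split=> //; first lra.
(* Since [q >= 3], 1/2 lies strictly below [(q - 1) / q]. *)
apply: (Rle_lt_trans _ (/ 2)); first lra.
rewrite /Rfrac -minusE minus_INR; last by apply/ssrnat.leP; lia.
apply: (Rmult_lt_reg_r (INR q)); first lra.
by rewrite /Rdiv Rmult_assoc Rinv_l /=; lra.
Qed.

End FamilyEntropy.

Local Close Scope R_scope.

(** * The cyclotomic factor of X^p - 1 *)

(* Imported only here because they redefine [Req_EM_T] and the tactic [field]. *)
From mathcomp Require Import Rstruct ring.

Lemma ord_mod_gt0P (m a : nat) : (0 < ord_mod m a)%N ->
  a ^ ord_mod m a = 1 %[mod m] /\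
  (forall k, 0 < k < ord_mod m a -> a ^ k != 1 %[mod m])%N.
Proof.
rewrite /ord_mod; set P := (fun k => _); set s := iota 0 m.
case: (ltnP (find P s) m) => // lt_find _.
have hasP : has P s by rewrite has_find [size s]size_iota.
split=> [|k /andP[k_gt0 lt_k]].
  by have /eqP := nth_find 0%N hasP; rewrite nth_iota // add0n.
rewrite -(prednK k_gt0) ltnS in lt_k *.
have := before_find 0%N lt_k; rewrite nth_iota; first by move/negbT.
by rewrite (ltn_trans lt_k) // -(size_iota 0 m) -has_find.
Qed.

(** A failed search returns 0, for which the bound is trivial. *)
Lemma ord_mod_leq (m a k : nat) : (0 < k <= m)%N -> a ^ k = 1 %[mod m] ->
  (ord_mod m a <= k)%N.
Proof.
case/andP=> k_gt0 k_le ak1; rewrite leqNgt; apply/negP=> lt_k.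
have [_ /(_ k)] := ord_mod_gt0P (leq_ltn_trans (leq0n k) lt_k).
by rewrite k_gt0 lt_k ak1 eqxx => /(_ isT).
Qed.

(** The order [e] of [q] modulo [p] is even, so [q ^ e] is 1 modulo 4 as well, hence modulo [4p].
    Therefore [p - 1 <= e]: [q] is a primitive root modulo [p]. *)
Lemma admissible_primeP (q p : nat) : q %% 4 = 3 -> admissible_prime q p ->
  [/\ prime p, p %% 4 = 3, coprime p q
    & forall k, (0 < k < p.-1)%N -> q ^ k != 1 %[mod p]].
Proof.
move=> q3 [p_pr p3 co_pq ord4p ordp]; split=> // k /andP[k_gt0 lt_k].
have ord_gt0 : (0 < ord_mod p q)%N by case: (ord_mod p q) ordp.
have [qe1 min_e] := ord_mod_gt0P ord_gt0.
apply: min_e; rewrite k_gt0 (leq_trans lt_k) // -ord4p.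
apply: ord_mod_leq.
  rewrite ord_gt0 (@leq_trans p) ?leq_pmull //.
  by rewrite /ord_mod; case: ltnP => // /ltnW.
apply/eqP; rewrite chinese_remainder; last first.
  by rewrite (@coprimeXl 2 2) // coprime_sym coprimen2 -[odd p]negbK -dvdn2; lia.
rewrite qe1 eqxx andbT.
have -> : ord_mod p q = (2 * (ord_mod p q)./2)%N by lia.
by rewrite expnM -modnXm -[(q ^ 2)%N]/(q * q)%N -modnMm q3 exp1n.
Qed.

Local Open Scope ring_scope.

Section GeometricSum.
Variable F : finFieldType.
Implicit Types (p : nat) (f g : {poly F}).

(** For prime [p] this is the [p]-th cyclotomic polynomial, the factor Phi of [X^p - 1]. *)
Definition geom p : {poly F} := \poly_(i < p) 1.

Lemma coef_geom p i : (geom p)`_i = (i < p)%:R.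
Proof. by rewrite coef_poly; case: ltnP. Qed.

Lemma size_geom p : size (geom p) = p.
Proof.
case: p => [|p]; first by rewrite /geom poly_def big_ord0 size_poly0.
by rewrite size_poly_eq ?oner_neq0.
Qed.

Lemma horner1_geom p : (geom p).[1] = p%:R.
Proof.
rewrite horner_poly -[in RHS](card_ord p) -sumr_const.
by apply: eq_bigr => i _; rewrite mul1r expr1n.
Qed.

Lemma mul_geom p : ('X - 1) * geom p = 'X^p - 1.
Proof.
rewrite subrX1 /geom poly_def; congr (_ * _); apply: eq_bigr => i _.
by rewrite scale1r.
Qed.

Lemma pnat_card_finField r : r \in [pchar F] -> r.-nat #|F|.
Proof. by move=> /fin_ring_pchar_abelem/abelem_pgroup; rewrite /pgroup cardsT. Qed.

Lemma natr_coprime_card p : prime p -> coprime p #|F| -> p%:R != 0 :> F.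
Proof.
move=> p_pr co_pq; apply/eqP=> p0.
have p_char : p \in [pchar F] by rewrite inE p_pr p0 eqxx.
have := finNzRing_gt1 F; rewrite (@pnat_1 p #|F|) ?pnat_card_finField //.
by rewrite p'natE // -prime_coprime.
Qed.

(* A root [z] of a factor in an extension field is a primitive [p]-th root of
   unity, and then so are the roots [z ^ (q ^ i)], [i < p - 1], which are
   distinct because [q] is a primitive root modulo [p]. *)
Lemma irreducible_geom p : prime p -> coprime p #|F| ->
  (forall k, (0 < k < p.-1)%N -> #|F| ^ k != 1 %[mod p])%N ->
  irreducible_poly (geom p).
Proof.
move=> p_pr co_pq qk_neq1; split=> [|g size_g g_dvd].
  by rewrite size_geom prime_gt1.
have geom_neq0 : geom p != 0 by rewrite -size_poly_gt0 size_geom prime_gt0.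
have g_neq0 := dvdpN0 g_dvd geom_neq0.
rewrite -(dvdp_size_eqp g_dvd) eqn_leq dvdp_leq //= size_geom.
have [L [rs g_rs _]] := FinSplittingFieldFor g_neq0.
have size_rs : size rs != 0%N.
  have := eqp_size g_rs; rewrite size_prod_XsubC size_map_poly => size_g_rs.
  by rewrite size_g_rs in size_g.
have [z z_root] : exists z, root (map_poly (in_alg L) g) z.
  case: rs size_rs g_rs => // z rs _ /eqp_root g_rs; exists z.
  by rewrite g_rs root_prod_XsubC mem_head.
(* The Frobenius map [x ^+ #|F|] fixes the coefficients, so it permutes the roots. *)
have {}qX (x : L) (f : {poly F}) : root (map_poly (in_alg L) f) x ->
    root (map_poly (in_alg L) f) (x ^+ #|F|).
  have [r r_pr charFr] := finPcharP F.
  have charLr : r \in [pchar L] by rewrite pchar_lalg.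
  have qL : [pchar L].-nat #|F|.
    by rewrite (eq_pnat _ (pcharf_eq charLr)) pnat_card_finField.
  rewrite !rootE => /eqP fx0.
  have -> : (map_poly (in_alg L) f).[x ^+ #|F|]
          = (map_poly (in_alg L) f).[x] ^+ #|F|.
    elim/poly_ind: f {fx0} => [|f c IHf].
      by rewrite rmorph0 !horner0 expr0n; case: #|F| (finNzRing_gt1 F).
    rewrite rmorphD rmorphM /= map_polyX map_polyC !hornerE exprDn_pchar //.
    by rewrite exprMn IHf -rmorphXn /= expf_card.
  by rewrite fx0 expr0n; case: #|F| (finNzRing_gt1 F).
have z_geom : root (map_poly (in_alg L) (geom p)) z.
  by apply: root_dvdp z_root; rewrite ?dvdp_map.
have zp1 : z ^+ p = 1.
  apply/eqP; rewrite -subr_eq0; have /(congr1 (map_poly (in_alg L))) := mul_geom p.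
  rewrite rmorphM => /(congr1 (horner^~ z)); rewrite hornerM (rootP z_geom) mulr0.
  by rewrite rmorphB rmorph1 rmorphXn /= map_polyX !hornerE => <-.
have z_neq1 : z != 1.
  apply: contraTneq z_geom => ->; rewrite rootE -(rmorph1 (in_alg L)) horner_map.
  by rewrite horner1_geom fmorph_eq0 natr_coprime_card.
have z_prim : p.-primitive_root z.
  have [m z_prim] := prim_order_exists (prime_gt0 p_pr) zp1.
  have /primeP[_ p_div] := p_pr; case/p_div/orP => /eqP m_eq; last by rewrite -m_eq.
  by case/eqP: z_neq1; rewrite -(prim_expr_order z_prim) m_eq expr1.
pose zs := [seq z ^+ (#|F| ^ i) | i <- iota 0 p.-1].
have uniq_zs : uniq zs.
  rewrite map_inj_in_uniq ?iota_uniq // => i j; rewrite !mem_iota !add0n /=.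
  wlog le_ij : i j / (i <= j)%N => [wl|] i_lt j_lt.
    by case: (leqP i j) => [|/ltnW] le_ij /eqP; [|rewrite eq_sym] =>
      /eqP /wl-> //.
  move/eqP; rewrite (eq_prim_root_expr z_prim) => eq_ij.
  apply: contraTeq eq_ij => neq_ij.
  (* The factor [#|F| ^ i] is prime to [p] and cancels, leaving a power of [q] with exponent below
     [p - 1]. *)
  rewrite eq_sym -(subnKC le_ij) expnD -[X in _ == X %[mod _]]muln1.
  rewrite eqn_mod_dvd ?leq_mul ?expn_gt0 ?(ltnW (finNzRing_gt1 F)) //.
  rewrite -mulnBr Gauss_dvdr ?coprimeXr //.
  rewrite -eqn_mod_dvd ?expn_gt0 ?(ltnW (finNzRing_gt1 F)) //.
  apply: qk_neq1; lia.
have zs_root : all (root (map_poly (in_alg L) g)) zs.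
  apply/allP=> _ /mapP[i _ ->]; elim: i => [|i IHi]; first by rewrite expr1.
  by rewrite expnSr exprM qX.
have := max_poly_roots _ zs_root uniq_zs.
rewrite map_poly_eq0 size_map_poly size_map size_iota => /(_ g_neq0).
by rewrite prednK // prime_gt0.
Qed.

End GeometricSum.

(** * Cayley transforms *)

Section Cayley.
Variables (F : finFieldType) (m : nat).
Let p := m.*2.+1.
Implicit Types (c : {ffun 'I_m -> F}) (f : {poly F}).

(** The element [s] modulo [X^p - 1], with [p - i.+1] in the role of the exponent [- i.+1];
    subtracting 2 makes it vanish at 1. *)
Definition sym_part c : {poly F} :=
  \sum_(i < m) c i *: ('X^(i.+1) + 'X^(p - i.+1) - 2%:R).

(** The element [t = z - 1/z], under the same convention. *)
Definition skew_part : {poly F} := 'X - 'X^(p.-1).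

Lemma size_sym_part c : (size (sym_part c) <= p)%N.
Proof.
apply: (leq_trans (size_sum _ _ _)); apply/bigmax_leqP => i _.
apply: (leq_trans (size_scale_leq _ _)).
apply: (leq_trans (size_polyD _ _)); rewrite geq_max size_polyN -polyC_natr.
rewrite (leq_trans (size_polyC_leq1 _)) // andbT.
apply: (leq_trans (size_polyD _ _)); rewrite geq_max !size_polyXn.
by have := ltn_ord i; lia.
Qed.

Lemma coef_skew_part k : skew_part`_k = (k == 1%N)%:R - (k == p.-1)%:R.
Proof. by rewrite coefB coefX coefXn. Qed.

Lemma coef_sym_part c k : (0 < k)%N ->
  (sym_part c)`_k = \sum_(i < m) c i * ((k == i.+1)%:R + (k == p - i.+1)%N%:R).
Proof.
move=> k_gt0; rewrite coef_sum; apply: eq_bigr => i _.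
by rewrite coefZ coefB coefD !coefXn -polyC_natr coefC (gtn_eqF k_gt0) subr0.
Qed.

Lemma sym_partB c c' : sym_part (c - c') = sym_part c - sym_part c'.
Proof.
by rewrite -sumrB; apply: eq_bigr => i _; rewrite !ffunE scalerBl.
Qed.

Lemma horner1_sym_part c : (sym_part c).[1] = 0.
Proof.
rewrite /sym_part horner_sum big1 // => i _.
by rewrite !hornerE !expr1n subrr mulr0.
Qed.

Hypothesis irr_geom : irreducible_poly (geom F p).

Lemma geom_multiple f : (size f <= p)%N -> ~~ coprimep (geom F p) f ->
  exists k, f = k *: geom F p.
Proof.
move=> size_f; rewrite irreducible_poly_coprime // negbK => /dvdpP[g def_f].
have [g0|g_neq0] := eqVneq g 0; first by exists 0; rewrite def_f g0 mul0r scale0r.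
have geom_neq0 : geom F p != 0 by rewrite -size_poly_gt0 size_geom.
exists g`_0; rewrite -mul_polyC -size1_polyC //.
move: size_f; rewrite def_f size_mul // size_geom /p addnS /=.
by rewrite -[(m.*2).+1]add1n leq_add2r.
Qed.

(** A multiple [k *: geom F p] takes the value [k p] at 1, where [sym_part c] vanishes, so [k = 0].
    The exponents [i.+1] stay at most [m] and the [p - i.+1] above [m], so each [c j] is a
    coefficient and is 0. *)
Lemma coprime_geom_sym_part c : p%:R != 0 :> F -> c != 0 ->
  coprimep (geom F p) (sym_part c).
Proof.
move=> p_neq0; apply: contraR => /(geom_multiple (size_sym_part c))[k def_c].
have k0 : k = 0.
  have := horner1_sym_part c; rewrite def_c hornerZ horner1_geom.
  by move/eqP; rewrite mulf_eq0 (negPf p_neq0) orbF => /eqP.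
apply/eqP/ffunP => j; rewrite ffunE.
have := coef_sym_part c (ltn0Sn j); rewrite def_c k0 scale0r coef0 => ->.
rewrite (bigD1 j) //= eqxx big1 => [|i neq_ij].
  suff -> : (j.+1 == p - j.+1)%N = false by rewrite !addr0 mulr1.
  by have := ltn_ord j; lia.
have -> : (j.+1 == i.+1) = false by rewrite eqSS eq_sym; apply: negPf.
have -> : (j.+1 == p - i.+1)%N = false by have := ltn_ord i; have := ltn_ord j; lia.
by rewrite addr0 mulr0.
Qed.

Hypothesis m_gt0 : (0 < m)%N.

Lemma size_skew_part : (size skew_part <= p)%N.
Proof.
apply: (leq_trans (size_polyD _ _)); rewrite geq_max size_polyN.
by rewrite size_polyX size_polyXn; lia.
Qed.

(** All coefficients of a multiple of [geom F p] below degree [p] agree, but here those at 1 and at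
    [X] are 0 and 1. *)
Lemma coprime_geom_skew_part : coprimep (geom F p) skew_part.
Proof.
apply/negPn/negP => /(geom_multiple size_skew_part)[k def_skew].
have := congr1 (fun f : {poly F} => f`_0) def_skew.
have := congr1 (fun f : {poly F} => f`_1) def_skew.
rewrite /= !coef_skew_part !coefZ !coef_geom /p /= ltnS double_gt0 m_gt0.
have [-> ->] : (1 == m.*2)%N = false /\ (0 == m.*2)%N = false by lia.
by rewrite !subr0 !mulr1 => <- /eqP; rewrite eq_sym oner_eq0.
Qed.

(* At [X = 1] the value is 1; and [1 + sym_part c - skew_part] is no multiple of
   [geom], since its coefficients at [X] and [X^(p-1)] differ by 2. *)
Lemma coprime_cayley_den c : 2%:R != 0 :> F ->
  coprimep (1 + sym_part c - skew_part) ('X^p - 1).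
Proof.
move=> two_neq0; rewrite -mul_geom coprimepMr; apply/andP; split.
  rewrite -polyC1 coprimep_XsubC rootE !hornerE.
  by rewrite horner1_sym_part expr1n subrr subr0 addr0 oner_eq0.
rewrite coprimep_sym; apply/negPn/negP => /geom_multiple[|k def_f].
  apply: (leq_trans (size_polyD _ _)); rewrite geq_max size_polyN size_skew_part andbT.
  by rewrite (leq_trans (size_polyD _ _)) // geq_max size_sym_part size_poly1.
have := congr1 (fun f : {poly F} => f`_1) def_f.
have := congr1 (fun f : {poly F} => f`_(p.-1)) def_f.
rewrite /= !coefZ !coef_geom !coefB !coefD !coef1 !coefX !coefXn.
have -> : (sym_part c)`_(p.-1) = (sym_part c)`_1.
  rewrite !coef_sym_part //; last by rewrite /p; lia.
  apply: eq_bigr => i _; congr (_ * _); rewrite addrC.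
  by congr (_ %:R + _ %:R); have := ltn_ord i; rewrite /p; lia.
rewrite /p /= !eqxx ltnSn ltnS double_gt0 m_gt0.
have [-> [-> ->]] : (m.*2 == 0)%N = false /\ (m.*2 == 1)%N = false /\
  (1 == m.*2)%N = false by lia.
move=> <- /eqP; rewrite -subr_eq0.
rewrite (_ : _ - _ = - 2%:R) ?oppr_eq0 ?(negPf two_neq0) //.
by rewrite /=; ring.
Qed.

End Cayley.

(** * Negacirculant matrices *)

Section Negashift.
Variables (F : fieldType) (n' : nat).
Local Notation n := n'.+1.

(** Multiplication by [x] modulo [x^n + 1] on row vectors. The second term is the wraparound,
    written so that the same formula describes all powers up to [n]. *)
Definition negashift : 'M[F]_n :=
  \matrix_(i, j) ((j == i + 1 :> nat)%N%:R - (j + n == i + 1 :> nat)%N%:R).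

Lemma negashift_mul (A : 'M[F]_n) (i j : 'I_n) :
  (negashift * A) i j =
    if insub i.+1 is Some i1 then A i1 j else - A ord0 j.
Proof.
rewrite mxE; case: insubP => [i1 _ /= i1E|/= i_max].
  rewrite (bigD1 i1) //= mxE i1E addn1 eqxx big1 => [|l neq_l].
    rewrite addr0; have -> : (i.+1 + n == i.+1)%N = false by lia.
    by rewrite subr0 mul1r.
  rewrite mxE addn1; have -> : (l == i.+1 :> nat) = false.
    by rewrite -i1E; apply: negbTE.
  have -> : (l + n == i.+1)%N = false by have := ltn_ord i1; lia.
  by rewrite subr0 mul0r.
have i1E : i.+1 = n by have := ltn_ord i; lia.
rewrite (bigD1 ord0) //= mxE addn1 i1E add0n eqxx big1 => [|l neq_l].
  by rewrite sub0r mulN1r addr0.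
rewrite mxE addn1 i1E; have -> : (l == n :> nat) = false by have := ltn_ord l; lia.
have -> : (l + n == n)%N = false.
  by move/eqP: neq_l => neq_l; apply/eqP=> l0; apply/neq_l/val_inj => /=; lia.
by rewrite subrr mul0r.
Qed.

Lemma negashiftX k : (k <= n)%N -> negashift ^+ k =
  \matrix_(i, j) ((j == i + k :> nat)%N%:R - (j + n == i + k :> nat)%N%:R).
Proof.
elim: k => [|k IHk] le_kn.
  rewrite expr0; apply/matrixP=> i j; rewrite !mxE addn0.
  have -> : (j + n == i)%N = false by have := ltn_ord i; lia.
  by rewrite subr0 eq_sym.
rewrite exprS; apply/matrixP=> i j; rewrite negashift_mul IHk 1?ltnW // mxE.
case: insubP => [i1 _ /= i1E|/= i_max]; first by rewrite !mxE i1E addSnnS.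
have i1E : i.+1 = n by have := ltn_ord i; lia.
rewrite mxE (addnS i k) -addSn i1E add0n.
have -> : (j + n == k)%N = false by lia.
have -> : (j == n + k :> nat)%N = false by have := ltn_ord j; lia.
by rewrite addnC eqn_add2l; ring.
Qed.

Lemma negashiftXn : negashift ^+ n = - 1.
Proof.
rewrite negashiftX //; apply/matrixP=> i j; rewrite !mxE.
have -> : (j == i + n :> nat)%N = false by have := ltn_ord j; lia.
by rewrite eqn_add2r sub0r eq_sym.
Qed.

(** As [negashift ^+ n = - 1], the right-hand side is the inverse power: transposition is
    [x |-> 1/x]. *)
Lemma tr_negashiftX k : (k <= n)%N ->
  (negashift ^+ k)^T = - negashift ^+ (n - k).
Proof.
move=> le_kn; rewrite !negashiftX ?leq_subr //; apply/matrixP=> i j.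
rewrite !mxE opprB; congr (_ %:R - _ %:R); lia.
Qed.

(** Reduction modulo [X^n + 1] does not change the value at [negashift]. In entry [(i, j)] only one
    power contributes: [j - i], or [n + j - i] with sign -1 after a wraparound. *)
Lemma negacirc_horner (a : {poly F}) : negacirc n a = horner_mx negashift a.
Proof.
have size_mod : size ('X^n + 1 : {poly F}) = n.+1 by rewrite size_XnaddC.
have -> : horner_mx negashift a = horner_mx negashift (a %% ('X^n + 1)).
  rewrite {1}(divp_eq a ('X^n + 1)) rmorphD rmorphM rmorphD rmorphXn rmorph1 /=.
  by rewrite horner_mx_X negashiftXn addNr mulr0 add0r.
rewrite /negacirc; set r := a %% _.
have size_r : (size r <= n)%N.
  by rewrite -ltnS -size_mod ltn_modp -size_poly_gt0 size_mod.
apply/matrixP=> i j.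
have -> : horner_mx negashift r = \sum_(k < n) r`_k *: negashift ^+ k.
  rewrite -[in LHS](coefK r) poly_def (big_ord_widen _ (fun k => r`_k *: 'X^k) size_r).
  rewrite big_mkcond rmorph_sum; apply: eq_bigr => k _ /=.
  case: ltnP => [_|/leq_sizeP-> //]; last by rewrite scale0r rmorph0.
  by rewrite linearZ rmorphXn /= horner_mx_X.
rewrite mxE summxE.
under eq_bigr => k _ do rewrite mxE negashiftX 1?ltnW // mxE.
have [lt_i lt_j] := (ltn_ord i, ltn_ord j).
case: leqP => [le_ij|lt_ji].
  have lt_k : (j - i < n)%N by lia.
  rewrite (bigD1 (Ordinal lt_k)) //= subnKC // eqxx.
  have -> : (j + n == j)%N = false by lia.
  rewrite subr0 mulr1 big1 ?addr0 // => k neq_k.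
  have -> : (j == i + k :> nat)%N = false.
    by apply: contraNF neq_k => /eqP jE; apply/eqP/val_inj => /=; lia.
  have -> : (j + n == i + k)%N = false by have := ltn_ord k; lia.
  by rewrite subrr mulr0.
have lt_k : (n + j - i < n)%N by lia.
rewrite (bigD1 (Ordinal lt_k)) //=.
have -> : (j == i + (n + j - i) :> nat)%N = false by lia.
have -> : (j + n == i + (n + j - i))%N by lia.
rewrite sub0r mulrN1 big1 ?addr0 // => k neq_k.
have -> : (j == i + k :> nat)%N = false by lia.
have -> : (j + n == i + k)%N = false.
  by apply: contraNF neq_k => /eqP jE; apply/eqP/val_inj => /=; lia.
by rewrite subrr mulr0.
Qed.

End Negashift.

Lemma two_neq0_odd (F : finFieldType) : odd #|F| -> 2%:R != 0 :> F.
Proof. by move=> oddF; rewrite natr_coprime_card // coprime2n. Qed.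

(* The sets of values of [x ^+ 2] and of [- 1 - x ^+ 2] both contain more than
   half of the field, so they meet. *)
Lemma sum_two_squares_opp1 (F : finFieldType) : odd #|F| ->
  exists a b : F, a ^+ 2 + b ^+ 2 = -1.
Proof.
move=> oddF; pose S := [set x ^+ 2 | x : F].
pose f (y : F) := - 1 - y.
have f_inj : injective f by move=> x y /addrI/oppr_inj.
have S_big : (#|F| <= 2 * #|S|)%N.
  rewrite -[leqLHS]sum1_card (partition_big_imset (fun x : F => x ^+ 2)) /=.
  apply: (@leq_trans (\sum_(y in S) 2)%N); last by rewrite sum_nat_const mulnC.
  apply: leq_sum => _ /imsetP[x _ ->]; rewrite sum1_card.
  apply: leq_trans (_ : #|[set x; - x]| <= 2)%N; last by rewrite cards2; case: eqP.
  by apply/subset_leq_card/subsetP => y; rewrite !inE -eqf_sqr.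
have [dis|[_ /setIP[/imsetP[a _ ->] /imsetP[_ /imsetP[b _ ->] ab]]]] :=
  set_0Vmem (S :&: f @: S).
  have := cardsUI S (f @: S).
  rewrite dis cards0 (card_imset _ f_inj) addn0 addnn -mul2n => cardU.
  have S_small : (2 * #|S| <= #|F|)%N by rewrite -cardU max_card.
  have /eqP cardF : #|F| == (2 * #|S|)%N by rewrite eqn_leq S_big.
  by move: oddF; rewrite cardF mul2n odd_double.
by exists a, b; rewrite ab /f subrK.
Qed.

Lemma horner_mx_comp (F : fieldType) n' (A : 'M[F]_n'.+1) (f g : {poly F}) :
  horner_mx A (f \Po g) = horner_mx (horner_mx A g) f.
Proof.
elim/poly_ind: f => [|f c IHf]; first by rewrite comp_poly0 !rmorph0.
rewrite comp_polyD comp_polyM comp_polyX comp_polyC !rmorphD !rmorphM /= IHf.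
by rewrite !horner_mx_C horner_mx_X.
Qed.

(** Multiplying a Bezout relation by [X - 1] writes [X - 1] as a combination of [X^p - 1], which
    vanishes at [Z], and of [f], whose value kills [u]. *)
Lemma mulmx_horner_coprime (F : finFieldType) n' p (Z : 'M[F]_n'.+1)
    (f : {poly F}) (u : 'rV_n'.+1) :
  Z ^+ p = 1 -> coprimep (geom F p) f -> u *m horner_mx Z f = 0 -> u *m Z = u.
Proof.
move=> Zp1 /Bezout_eq1_coprimepP[[g h] /= bezout] uf0.
apply/eqP; rewrite -subr_eq0 -{2}[u]mulmx1 -mulmxBr; apply/eqP.
have -> : Z - 1%:M = horner_mx Z ('X - 1).
  by rewrite rmorphB /= horner_mx_X !rmorph1.
have -> : 'X - 1 = g * ('X^p - 1) + f * (h * ('X - 1)).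
  by rewrite -[LHS]mulr1 -[X in _ * X = _]bezout -mul_geom; ring.
rewrite rmorphD !rmorphM rmorphB rmorphXn rmorph1 /= horner_mx_X Zp1 subrr mulr0.
by rewrite add0r [LHS]mulmxA uf0 mul0mx.
Qed.

(** * Orthogonal Cayley transforms among negacirculant matrices *)

Section Family.
Variables (F : finFieldType) (m n' : nat).
Let p := m.*2.+1.
Local Notation n := n'.+1.
Hypothesis n_eq : n = p.*2.
Implicit Types (c : {ffun 'I_m -> F}) (u : 'rV[F]_n).

Local Notation T := (negashift F n').

(** The matrix of [z = - x^2]; as [p] is odd, the sign turns [x^(2p) = -1] into [z^p = 1]. *)
Definition negashift2 : 'M[F]_n := - T ^+ 2.
Local Notation Z := negashift2.

Lemma negashift2X k : Z ^+ k = (-1) ^+ k * T ^+ k.*2.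
Proof. by rewrite [LHS]exprNn -exprM mul2n. Qed.

Lemma negashift2Xp : Z ^+ p = 1.
Proof.
by rewrite negashift2X -n_eq negashiftXn -signr_odd /p /= odd_double expr1 mulrNN mulr1.
Qed.

(** Since [p] is odd, [k] and [p - k] have opposite parities, which cancels the sign in
    [tr_negashiftX]. *)
Lemma tr_negashift2X k : (k <= p)%N -> (Z ^+ k)^T = Z ^+ (p - k).
Proof.
move=> le_kp; rewrite !negashift2X -signr_odd -[in RHS]signr_odd oddB //.
have -> : odd p by rewrite /p /= odd_double.
rewrite !mulr_sign.
have tr_T : (T ^+ k.*2)^T = - T ^+ (p - k).*2.
  have -> : (p - k).*2 = (n - k.*2)%N by rewrite n_eq doubleB.
  by rewrite tr_negashiftX // n_eq leq_double.
by case: (odd k); rewrite /= ?[LHS]linearN /= tr_T ?opprK.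
Qed.

Lemma tr_horner_sym_part c :
  (horner_mx Z (sym_part c))^T = horner_mx Z (sym_part c).
Proof.
rewrite rmorph_sum linear_sum; apply: eq_bigr => i _ /=.
rewrite !linearZ rmorphB rmorphD !rmorphXn rmorph_nat /= horner_mx_X.
have le_ip : (i.+1 <= p)%N by have := ltn_ord i; rewrite /p; lia.
congr (_ *: _); rewrite -/p linearB linearD linearMn /= trmx1.
by rewrite !tr_negashift2X ?leq_subr // subKn //; congr (_ - _); rewrite addrC.
Qed.

Lemma tr_horner_skew_part :
  (horner_mx Z (skew_part F m))^T = - horner_mx Z (skew_part F m).
Proof.
rewrite rmorphB rmorphXn /= horner_mx_X linearB /= opprB.
by rewrite -{1}[Z]expr1 !tr_negashift2X // /p subn1 /= subSnn expr1.
Qed.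

Definition cayley_num c : {poly F} := 1 + sym_part c + skew_part F m.
Definition cayley_den c : {poly F} := 1 + sym_part c - skew_part F m.

Lemma tr_horner_cayley_den c :
  (horner_mx Z (cayley_den c))^T = horner_mx Z (cayley_num c).
Proof.
rewrite rmorphB [RHS]rmorphD !(rmorphD _ 1) rmorph1 /= linearB linearD /= trmx1.
by rewrite tr_horner_sym_part tr_horner_skew_part opprK.
Qed.

(** Up to sign [u] is invariant under the shift by 2, so a nonzero coordinate [i] gives [p] distinct
    ones, [i + 2k] modulo [n = 2p]. *)
Lemma wt_fixed u : u *m Z = u -> u != 0 -> (p <= wt u)%N.
Proof.
move=> uZ u_neq0.
have uZX k : u *m Z ^+ k = u.
  by elim: k => [|k IHk]; [rewrite mulmx1 | rewrite exprSr mulmxA IHk].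
have [i ui_neq0] : exists i, u 0 i != 0.
  apply/existsP; apply: contraR u_neq0 => /existsPn u0.
  by apply/eqP/rowP=> i; rewrite mxE; apply/eqP/negPn/u0.
have lt_shift k : ((i + k.*2) %% n < n)%N by rewrite ltn_mod.
pose shift (k : 'I_p) := Ordinal (lt_shift k).
have shift_inj : injective shift.
  move=> k l /(congr1 val)/= /eqP; rewrite eqn_modDl n_eq -!muln2 -!muln_modl.
  rewrite eqn_pmul2r // !modn_small // => /eqP; exact: val_inj.
rewrite -[X in (X <= _)%N]card_ord -(card_imset predT shift_inj).
apply/subset_leq_card/subsetP => _ /imsetP[k _ ->]; rewrite inE.
have := uZX k; rewrite negashift2X => /(congr1 (fun v : 'rV_n => v 0 (shift k))) <-.
have le_k : (k.*2 <= n)%N by have := ltn_ord k; lia.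
rewrite -signr_odd mulr_sign.
have -> : (u *m (if odd k then - T ^+ k.*2 else T ^+ k.*2)) 0 (shift k)
  = (-1) ^+ odd k * (u *m T ^+ k.*2) 0 (shift k).
  by case: (odd k); rewrite ?mulmxN ?mxE ?mulN1r ?mul1r // ?mxE.
pose s := ((i + k.*2) %% n)%N.
have s_eq : s = (i + k.*2)%N \/ (s + n)%N = (i + k.*2)%N.
  rewrite /s; have [lt_n|le_n] := ltnP (i + k.*2) n.
    by left; rewrite modn_small.
  right; rewrite -[in (_ %% _)%N](subnK le_n) modnDr modn_small ?subnK //.
  by have := ltn_ord i; lia.
rewrite mulf_neq0 ?signr_eq0 // negashiftX // mxE (bigD1 i) //= big1.
  rewrite addr0 mxE mulf_neq0 //= -/s.
  case: s_eq => s_eq.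
    have [-> ->] : (s == i + k.*2)%N = true /\ (s + n == i + k.*2)%N = false by lia.
    by rewrite subr0 oner_neq0.
  have [-> ->] : (s == i + k.*2)%N = false /\ (s + n == i + k.*2)%N = true by lia.
  by rewrite sub0r oppr_eq0 oner_neq0.
move=> l neq_li; rewrite mxE /= -/s.
have {}neq_li : nat_of_ord l <> i by move=> eq_li; case/eqP: neq_li; apply: val_inj.
have [-> ->] : (s == l + k.*2)%N = false /\ (s + n == l + k.*2)%N = false.
  by have := ltn_ord l; have := ltn_ord i; lia.
by rewrite subrr mulr0.
Qed.

Hypothesis p_neq0 : p%:R != 0 :> F.
Hypothesis two_neq0 : 2%:R != 0 :> F.
Hypothesis m_gt0 : (0 < m)%N.
Hypothesis irr_geom : irreducible_poly (geom F p).

Lemma cayleyP c : exists g : {poly F},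
  horner_mx Z (cayley_den c) * horner_mx Z g = 1.
Proof.
have /Bezout_eq1_coprimepP[[g h] /= bezout] :=
  coprime_cayley_den irr_geom m_gt0 c two_neq0.
exists g; rewrite -rmorphM mulrC -(rmorph1 (horner_mx Z)) -bezout rmorphD.
rewrite [X in _ + X]rmorphM rmorphB rmorphXn rmorph1 /= horner_mx_X.
by rewrite negashift2Xp subrr mulr0 addr0.
Qed.

Variables (a b : F) (sq_ab : a ^+ 2 + b ^+ 2 = - 1).

Definition base_poly : {poly F} := a%:P + b%:P * 'X^p.

(** [T ^+ p] is skew with square -1, so the product is [a^2 + b^2]. *)
Lemma mul_base_tr : horner_mx T base_poly *m (horner_mx T base_poly)^T = - 1%:M.
Proof.
have -> : horner_mx T base_poly = a *: 1 + b *: T ^+ p.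
  by rewrite rmorphD rmorphM rmorphXn /= horner_mx_X !horner_mx_C
    [_%:M * _]mul_scalar_mx -scalemx1.
have TpTp : T ^+ p * T ^+ p = - 1 by rewrite -exprD addnn -n_eq negashiftXn.
have -> : (a *: 1 + b *: T ^+ p)^T = a *: 1 - b *: T ^+ p.
  have tr_Tp : (T ^+ p)^T = - T ^+ p.
    have {2}-> : p = (n - p)%N by rewrite n_eq -addnn addnK.
    by rewrite tr_negashiftX // n_eq -addnn leq_addr.
  by rewrite linearD !linearZ /= trmx1 tr_Tp scalerN.
rewrite -[LHS]/(_ * _ : 'M_n) mulrDl !mulrBr -!scalerAl -!scalerAr !mulr1 !mul1r TpTp.
rewrite !scalerA [b * a]mulrC addrA subrK scalerN opprK -scalerDl -!expr2.
by rewrite sq_ab scaleN1r.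
Qed.

(* [h c] is [base_poly], which has norm [-1], times the Cayley transform of [c]
   at [- X ^ 2], which has norm 1. *)
Lemma family_exists : exists h : {ffun 'I_m -> F} -> {poly F},
  (forall c, negacirc n (h c) *m (negacirc n (h c))^T = - 1%:M) /\
  (forall c c' u, c != c' ->
    u *m negacirc n (h c) = u *m negacirc n (h c') -> u *m Z = u).
Proof.
have [g gP] := fin_all_exists cayleyP.
pose N c := horner_mx Z (cayley_den c); pose P c := horner_mx Z (cayley_num c).
pose B c := horner_mx Z (g c); pose K := horner_mx T base_poly.
have comm_Z f f' : horner_mx Z f * horner_mx Z f' = horner_mx Z f' * horner_mx Z f.
  by rewrite -!rmorphM mulrC.
have ZE : Z = horner_mx T (- 'X ^+ 2) by rewrite rmorphN rmorphXn /= horner_mx_X.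
pose h c := ((cayley_num c * g c) \Po (- 'X ^+ 2)) * base_poly.
have hE c : negacirc n (h c) = P c * B c *m K.
  by rewrite negacirc_horner /h [LHS]rmorphM /= horner_mx_comp -ZE rmorphM.
have BN c : B c * N c = 1 by rewrite comm_Z gP.
exists h; split=> [c|c c' u neq_cc' uH].
  (* Transposition exchanges [N c] and [P c], so [(B c)^T] inverts [P c]. *)
  have PB_tr : P c * B c *m (P c * B c)^T = 1.
    have -> : (P c * B c)^T = (B c)^T * N c.
      by rewrite [LHS]trmx_mul /P -tr_horner_cayley_den trmxK.
    have PBt : P c * (B c)^T = 1.
      by rewrite /P -tr_horner_cayley_den -[LHS]trmx_mul [_ *m _]BN trmx1.
    by rewrite [P c * _]comm_Z -[LHS]/(_ * _) mulrA -(mulrA (B c)) PBt mulr1.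
  rewrite hE trmx_mul mulmxA -[_ *m K *m _]mulmxA mul_base_tr.
  by rewrite mulmxN mulmx1 mulNmx PB_tr.
(* The common factor [K] is cancelled by means of [K^T], its inverse up to sign. *)
have {}uH : u *m (P c * B c) = u *m (P c' * B c').
  move: (congr1 (mulmx^~ K^T) uH); rewrite /= !hE -!mulmxA mul_base_tr.
  by rewrite !mulmxN !mulmx1 => /oppr_inj.
have {}uH : u *m (P c * N c') = u *m (P c' * N c).
  move: (congr1 (mulmx^~ (N c * N c')) uH).
  rewrite /= -!(mulmxA u) [_ *m (N c * N c')](_ : _ = P c * N c'); last first.
    by rewrite -[LHS]/(_ * _) mulrA -(mulrA (P c)) BN mulr1.
  rewrite [P c' * B c' *m _](_ : _ = P c' * N c) //.
  by rewrite (comm_Z _ (cayley_den c')) -[LHS]/(_ * _) mulrA -(mulrA (P c')) BN mulr1.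
(* With denominators cleared, the difference of the cross products is [2 t (s' - s)], and each
   factor is prime to [geom F p]. *)
apply: (@mulmx_horner_coprime _ _ p _
  (2%:R *: (skew_part F m * sym_part (c' - c)))).
- exact: negashift2Xp.
- rewrite coprimepZr // coprimepMr (coprime_geom_skew_part irr_geom) //=.
  by rewrite (coprime_geom_sym_part irr_geom) // subr_eq0 eq_sym.
have -> : 2%:R *: (skew_part F m * sym_part (c' - c))
        = cayley_num c * cayley_den c' - cayley_num c' * cayley_den c.
  rewrite sym_partB scaler_nat /cayley_num /cayley_den.
  by move: (skew_part F m) => s; ring.
by rewrite rmorphB !rmorphM mulmxBr -/(P c) -/(N c) -/(P c') -/(N c') uH subrr.
Qed.

End Family.

(** * Codes and balls *)

Section Codes.
Variable F : finFieldType.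

Lemma wt_row_mx k l (x : 'rV[F]_k) (y : 'rV[F]_l) :
  wt (row_mx x y) = (wt x + wt y)%N.
Proof.
rewrite /wt -!sum1dep_card big_split_ord /=.
by congr (_ + _)%N; apply: eq_bigl => i; rewrite ?row_mxEl ?row_mxEr.
Qed.

Lemma wtN k (x : 'rV[F]_k) : wt (- x) = wt x.
Proof. by apply: eq_card => i; rewrite !inE mxE oppr_eq0. Qed.

Lemma wt_leq k (x : 'rV[F]_k) : (wt x <= k)%N.
Proof. by rewrite -[leqRHS]card_ord max_card. Qed.

Lemma wt_cast k l (e : k = l) (x : 'rV[F]_k) : wt (castmx (erefl, e) x) = wt x.
Proof. by case: l / e. Qed.

Lemma castmx_col_inj r k l (e : k = l) : injective (@castmx F r k r l (erefl, e)).
Proof. by case: l / e => x y; rewrite !castmx_id. Qed.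

Section MinDist.
Variables (N : nat) (C : {set 'rV[F]_N}).

Lemma min_dist_leq x : x \in C -> x != 0 -> (min_dist C <= wt x)%N.
Proof.
move=> xC x_neq0; rewrite /min_dist.
have : x \in index_enum ('rV[F]_N) by rewrite mem_index_enum.
elim: (index_enum _) => //= y s IHs; rewrite inE big_cons.
case/predU1P => [<-|/IHs]; first by rewrite xC x_neq0 geq_minl.
by case: ifP => // _; rewrite geq_min orbC => ->.
Qed.

Lemma min_dist_attained x0 : x0 \in C -> x0 != 0 ->
  exists x, [/\ x \in C, x != 0 & wt x = min_dist C].
Proof.
move=> x0C x0_neq0.
have Px0 : [pred x in C | x != 0] x0 by rewrite /= x0C.
have [x /andP[xC x_neq0] x_min] := arg_minnP (@wt F N) Px0.
exists x; split=> //; apply/eqP; rewrite eqn_leq min_dist_leq // andbT.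
(* The default value [N] of the minimum is harmless, no weight exceeding it. *)
apply: (big_ind (fun d => wt x <= d)%N) => [|d e|y]; first exact: wt_leq.
  by rewrite leq_min => -> ->.
exact: x_min.
Qed.

End MinDist.

Section DoubleCode.
Variables (k : nat) (M : 'M[F]_k).
Hypothesis MMt : M *m M^T = - 1%:M.

Local Notation code := (gen_code (row_mx 1%:M M)).

Lemma mem_double_code (x : 'rV[F]_(k + k)) :
  (x \in code) = (x == row_mx (lsubmx x) (lsubmx x *m M)).
Proof.
rewrite inE; apply/idP/eqP => [/submxP[u ->]|eq_x].
  by rewrite mul_mx_row mulmx1 row_mxKl.
by apply/submxP; exists (lsubmx x); rewrite {1}eq_x mul_mx_row mulmx1.
Qed.

Lemma mem_double_codeP u v : reflect (v = u *m M) (row_mx u v \in code).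
Proof.
by rewrite mem_double_code row_mxKl; apply: (iffP eqP) => [/eq_row_mx[]|->].
Qed.

Lemma tr_mulmx_opp1 : M^T *m M = - 1%:M.
Proof.
have : M *m (- M^T) = 1%:M by rewrite mulmxN MMt opprK.
by move/mulmx1C; rewrite mulNmx => <-; rewrite opprK.
Qed.

Lemma self_dual_double_code : self_dual code.
Proof.
apply/setP=> y; rewrite -[y]hsubmxK; move: (lsubmx y) (rsubmx y) => {y} u v.
rewrite [RHS]inE; apply/mem_double_codeP/forall_inP => [-> x|dual_uv].
  rewrite -[x]hsubmxK => /mem_double_codeP->.
  rewrite tr_row_mx mul_row_col trmx_mul mulmxA -(mulmxA _ M) MMt.
  by rewrite mulmxN mulmx1 mulNmx subrr.
have uMv : u^T + M *m v^T = 0.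
  rewrite -[LHS]mul1mx; apply/row_matrixP=> i; rewrite row_mul row0 mulmxDr.
  apply/eqP; rewrite mulmxA -mul_row_col -tr_row_mx; apply: dual_uv.
  exact/mem_double_codeP.
(* Transposing and multiplying by [M] gives [u M - v = 0]. *)
move: (congr1 (fun A => A^T *m M) uMv).
rewrite /= linearD /= trmxK trmx_mul trmxK trmx0 mul0mx mulmxDl -mulmxA tr_mulmx_opp1.
by rewrite mulmxN mulmx1 => /eqP; rewrite subr_eq0 => /eqP.
Qed.

(** A row of the generator matrix; it makes the minimum distance attained and bounds it. *)
Lemma double_code_neq0 : (0 < k)%N ->
  exists x, [/\ x \in code, x != 0 & (wt x <= k.+1)%N].
Proof.
move=> k_gt0; pose i := Ordinal k_gt0.
exists (row_mx (delta_mx 0 i) (delta_mx 0 i *m M)); split.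
- exact/mem_double_codeP.
- apply/eqP => /(congr1 (fun x => lsubmx x 0 i)).
  by rewrite row_mxKl linear0 !mxE !eqxx => /eqP; rewrite oner_eq0.
rewrite wt_row_mx -[leqRHS]add1n leq_add ?wt_leq // -[leqRHS](card1 i).
apply/subset_leq_card/subsetP => j; rewrite !inE mxE eqxx /=.
by case: (j == i) => //; rewrite eqxx.
Qed.

End DoubleCode.

Definition ball_card N d := #|[set x : 'rV[F]_N | (wt x <= d)%N]|.

(** The ball contains all words supported on the first [k] coordinates. *)
Lemma ball_card_expn N d k : (k <= N)%N -> (k <= d)%N -> (#|F| ^ k <= ball_card N d)%N.
Proof.
move=> le_kN le_kd.
pose f (u : 'rV[F]_k) : 'rV[F]_N := castmx (erefl, subnKC le_kN) (row_mx u 0).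
have f_inj : injective f.
  by move=> u v /castmx_col_inj/eq_row_mx[].
rewrite -[k]mul1n -card_mx -(card_imset _ f_inj); apply/subset_leq_card/subsetP.
move=> _ /imsetP[u _ ->]; rewrite inE wt_cast wt_row_mx.
rewrite [wt 0](_ : _ = 0)%N; first by rewrite addn0 (leq_trans (wt_leq _)).
by apply/eqP; rewrite cards_eq0; apply/eqP/setP=> i; rewrite !inE mxE eqxx.
Qed.

(* If the bound failed, words of minimum weight in the [#|I|] codes could not be
   distinct, so two codes would share one; its weight is at least [d], and
   already the ball of radius [d] has [#|F| ^ d] elements. *)
Lemma pigeonhole_min_dist (I : finType) k (M : I -> 'M[F]_k) d :
  (0 < k)%N -> (0 < #|I|)%N -> (d <= k)%N -> (#|I| <= #|F| ^ d)%N ->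
  (forall i j u, i != j -> u *m M i = u *m M j -> u != 0 -> (d <= wt u)%N) ->
  exists i, (#|I| <= ball_card (k + k) (min_dist (gen_code (row_mx 1%:M (M i)))))%N.
Proof.
move=> k_gt0 I_gt0 le_dk card_I wt_M.
pose C i := gen_code (row_mx 1%:M (M i)).
have /fin_all_exists[w wP] i : exists x, [/\ x \in C i, x != 0 & wt x = min_dist (C i)].
  have [x0 [x0C x0_neq0 _]] := double_code_neq0 (M i) k_gt0.
  exact: min_dist_attained x0_neq0.
have /card_gt0P[i0 _] := I_gt0.
(* With the largest minimum distance as radius, one ball holds the chosen words of all the codes. *)
have [i _ i_max] := @arg_maxnP _ i0 predT (fun i => min_dist (C i)) isT.
exists i; rewrite -/(C i) leqNgt; apply/negP => lt_ball.
have w_ball l : w l \in [set x | (wt x <= min_dist (C i))%N].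
  by have [_ _ wt_w] := wP l; rewrite inE wt_w; apply: i_max.
have /injectivePn[j [l neq_jl eq_w]] : ~~ injectiveb w.
  apply: contraL lt_ball => /injectiveP w_inj; rewrite -leqNgt.
  rewrite -[leqLHS](card_imset predT w_inj).
  by apply/subset_leq_card/subsetP => _ /imsetP[l _ ->].
have [wjC wj_neq0 wt_wj] := wP j; have [wlC _ _] := wP l.
rewrite -eq_w in wlC; move: wjC wlC wj_neq0 wt_wj.
rewrite -[w j]hsubmxK => /mem_double_codeP eq_j /mem_double_codeP eq_l.
move: (lsubmx _) (rsubmx _) eq_j eq_l => u v eq_j eq_l w_neq0 wt_w.
have u_neq0 : u != 0.
  by apply: contraNneq w_neq0 => u0; rewrite eq_j u0 mul0mx row_mx0.
have le_d : (d <= min_dist (C i))%N.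
  apply: leq_trans (i_max j isT); rewrite -wt_w wt_row_mx.
  by rewrite (leq_trans _ (leq_addr _ _)) // (wt_M j l) // -eq_j.
move: lt_ball; rewrite ltnNge (leq_trans card_I) // ball_card_expn //.
by rewrite (leq_trans le_dk) // leq_addr.
Qed.

End Codes.

(* Weight enumerator of the whole space, evaluated at [x] and truncated. *)
Lemma ball_card_weight_enum (F : finFieldType) (R : realFieldType) N d (x : R) :
  0 <= x <= 1 ->
  (ball_card F N d)%:R * x ^+ d <= (1 + #|F|.-1%:R * x) ^+ N.
Proof.
case/andP=> x_ge0 x_le1.
have -> : (1 + #|F|.-1%:R * x) ^+ N = \sum_(v : 'rV[F]_N) x ^+ wt v.
  have rowK : {on predT, bijective (fun f : {ffun 'I_N -> F} => \row_i f i)}.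
    exists (fun v : 'rV_N => [ffun i => v 0 i]) => [f _|v _].
      by apply/ffunP=> i; rewrite ffunE mxE.
    by apply/rowP=> i; rewrite mxE ffunE.
  rewrite (reindex _ rowK) /=.
  (* A coordinate contributes 1 for the letter 0 and [x] for any other; expanding the product sums
     over all words. *)
  transitivity (\prod_(i < N) \sum_(y : F) (if y != 0 then x else 1)).
    have -> : \sum_(y : F) (if y != 0 then x else 1) = 1 + \sum_(y : F | y != 0) x.
      by rewrite (bigD1 0) //= eqxx; congr (_ + _); apply: eq_bigr => y ->.
    rewrite sumr_const prodr_const card_ord mulr_natl; congr ((_ + _ *+ _) ^+ _).
    by rewrite cardC1.
  rewrite bigA_distr_bigA; apply: eq_bigr => f _ /=.
  rewrite -big_mkcond /= prodr_const /wt; congr (_ ^+ _).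
  by apply: eq_card => i; rewrite !inE mxE.
rewrite mulr_natl -sumr_const.
rewrite [leRHS](bigID [pred v | v \in [set v : 'rV[F]_N | (wt v <= d)%N]]) /=.
rewrite ler_wpDr ?sumr_ge0 // => [v _|]; first exact: exprn_ge0.
apply: ler_sum => v; rewrite inE => wt_v; exact: ler_wiXn2l.
Qed.

Local Close Scope ring_scope.

Local Open Scope R_scope.

(** The logarithm of [q^k x^d <= (1 + (q - 1) x)^N]. *)
Lemma ball_card_chernoff (F : finFieldType) N d k (x : R) : 0 < x <= 1 ->
  (#|F| ^ k <= ball_card F N d)%N ->
  INR k * ln (INR #|F|) + INR d * ln x <= INR N * ln (1 + (INR #|F| - 1) * x).
Proof.
move=> [x_gt0 x_le1] le_ball.
have q_ge2 : 2 <= INR #|F|.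
  by apply: (le_INR 2); apply/ssrnat.leP; exact: finNzRing_gt1.
have enum : INR #|F| ^ k * x ^ d <= (1 + (INR #|F| - 1) * x) ^ N.
  have x_bnd : (0 <= x <= 1)%O by apply/andP; split; apply/RleP; lra.
  have /RleP := ball_card_weight_enum F N d x_bnd.
  rewrite -!RpowE -!INRE => enum.
  apply: (Rle_trans _ (INR (ball_card F N d) * x ^ d)).
    apply: Rmult_le_compat_r; first by apply: pow_le; lra.
    have -> : INR #|F| ^ k = INR (#|F| ^ k)%N by rewrite RpowE !INRE natrX.
    exact/le_INR/ssrnat.leP.
  apply: (Rle_trans _ _ _ enum); right; congr (pow _ _).
  have -> : INR #|F| = INR #|F|.-1 + 1.
    by rewrite -S_INR prednK // (ltnW (finNzRing_gt1 F)).
  by rewrite Rplus_minus_r.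
have qk_gt0 : 0 < INR #|F| ^ k by apply: pow_lt; lra.
have xd_gt0 : 0 < x ^ d by apply: pow_lt.
rewrite -!ln_pow //; [|nra|lra]; rewrite -ln_mult //.
by apply: Rcomplements.ln_le => //; apply: Rmult_lt_0_compat.
Qed.

Local Close Scope R_scope.

(** * The two families *)

Local Open Scope ring_scope.

Section Existence.
Variable F : finFieldType.
Hypothesis card_F : (#|F| %% 4 = 3)%N.

Lemma exists_double_negacirc p : admissible_prime #|F| p ->
  exists h : {poly F},
    negacirc (2 * p) h *m (negacirc (2 * p) h)^T = - 1%:M /\
    (#|F| ^ p./2 <=
       ball_card F (2 * p + 2 * p) (min_dist (double_negacirc_code (2 * p) h)))%N.
Proof.
move=> /(admissible_primeP card_F)[p_pr p3 co_pq qk_neq1].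
have oddF : odd #|F| by move: card_F; lia.
have two_neq0 := two_neq0_odd oddF.
have [a [b sq_ab]] := sum_two_squares_opp1 oddF.
have p_neq0 := natr_coprime_card p_pr co_pq.
have irr_geom := irreducible_geom p_pr co_pq qk_neq1.
have p_eq : p = (p./2).*2.+1 by lia.
have p2_gt0 : (0 < p./2)%N by lia.
have : (2 * p)%N = p.*2 by rewrite mul2n.
case: (2 * p)%N => [|n'] n_eq; first by lia.
rewrite p_eq in n_eq p_neq0 irr_geom.
have [h [h_opp1 h_inj]] :=
  family_exists n_eq p_neq0 two_neq0 p2_gt0 irr_geom sq_ab.
pose M c := negacirc n'.+1 (h c).
have card_c : #|{ffun 'I_(p./2) -> F}| = (#|F| ^ p./2)%N.
  by rewrite card_ffun card_ord.
(* The threshold [p./2] makes [#|F| ^ d] the number of codes; shared words even have left halves of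
   weight at least [p]. *)
have [] := @pigeonhole_min_dist F {ffun 'I_(p./2) -> F} n'.+1 M p./2 => //.
- by rewrite card_c expn_gt0 (ltnW (finNzRing_gt1 F)).
- by rewrite n_eq; lia.
- by rewrite card_c.
- move=> c c' u neq_cc' /(h_inj _ _ _ neq_cc') uZ u_neq0.
  by apply: leq_trans _ (wt_fixed n_eq uZ u_neq0); lia.
by move=> c; rewrite card_c => ball_c; exists (h c).
Qed.

End Existence.

(** * Four-negacirculant codes with second polynomial 0 *)

Section FourCode.
Variables (F : finFieldType) (n : nat) (h : {poly F}).
Hypothesis hh_opp1 : negacirc n h *m (negacirc n h)^T = - 1%:M.
Local Notation A := (negacirc n h).

Lemma four_negacirc_code0E : four_negacirc_code n h 0 =
  gen_code (row_mx 1%:M (block_mx A 0 0 A^T)).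
Proof.
have B0 : negacirc n (0 : {poly F}) = 0.
  by apply/matrixP=> i j; rewrite !mxE mod0p !coef0 oppr0 if_same.
by rewrite /four_negacirc_code B0 trmx0 oppr0 -scalar_mx_block.
Qed.

Lemma four_block_opp1 : block_mx A 0 0 A^T *m (block_mx A 0 0 A^T)^T = - 1%:M.
Proof.
rewrite tr_block_mx !trmx0 trmxK mulmx_block !mulmx0 !mul0mx !addr0 !add0r.
by rewrite hh_opp1 tr_mulmx_opp1 // scalar_mx_block opp_block_mx oppr0.
Qed.

(** A codeword is [(u, v, u A, v A^T)]. If [u] is nonzero, [(u, u A)] is a nonzero word of the
    double code; otherwise [(v A^T, - v)] is one, because [A^T A = -1]. *)
Lemma min_dist_double_leq_four : (0 < n)%N ->
  (min_dist (double_negacirc_code n h) <= min_dist (four_negacirc_code n h 0))%N.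
Proof.
move=> n_gt0; rewrite four_negacirc_code0E.
have [x0 [x0C x0_neq0 _]] :=
  double_code_neq0 (block_mx A 0 0 A^T) (leq_trans n_gt0 (leq_addr _ _)).
have [x [xC x_neq0 <-]] := min_dist_attained x0C x0_neq0.
move: xC x_neq0; rewrite -[x]hsubmxK => /mem_double_codeP ->.
rewrite -[lsubmx x]hsubmxK; move: (lsubmx _) (rsubmx _) => u v.
rewrite mul_row_block !mulmx0 addr0 add0r => uv_neq0.
rewrite !wt_row_mx addnACA.
have [u0|u_neq0] := eqVneq u 0; last first.
  apply: leq_trans (leq_addr _ _); rewrite -wt_row_mx min_dist_leq //.
    exact/mem_double_codeP.
  apply: contraNneq u_neq0 => /(congr1 (@lsubmx _ _ _ _)).
  by rewrite row_mxKl linear0 => ->.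
apply: leq_trans (leq_addl _ _); rewrite addnC -(wtN v) -wt_row_mx min_dist_leq //.
  by apply/mem_double_codeP; rewrite -mulmxA tr_mulmx_opp1 // mulmxN mulmx1.
apply: contraNneq uv_neq0 => /(congr1 (@rsubmx _ _ _ _)).
rewrite row_mxKr linear0 => /eqP; rewrite oppr_eq0 u0 => /eqP->.
by rewrite !mul0mx !row_mx0.
Qed.

End FourCode.

Local Close Scope ring_scope.

Theorem theorem5p2 (F : finFieldType)
  (Hq3 : #|F| %% 4 = 3)
  (Hinf : forall m : nat, exists p : nat, m < p /\ admissible_prime #|F| p) :
  (* (1) self-dual double-negacirculant codes, n = 2p, length 2n = 4p *)
  (exists (p : nat -> nat) (h : nat -> {poly F}) (delta : R),
     (forall k, admissible_prime #|F| (p k)) /\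
     (forall k, p k < p k.+1) /\
     (forall k, self_dual (double_negacirc_code (2 * p k) (h k))) /\
     is_liminf (fun k => Rfrac (min_dist (double_negacirc_code (2 * p k) (h k)))
                               (2 * (2 * p k))) delta /\
     Rle 0 delta /\ Rlt delta (Rfrac (#|F| - 1) #|F|) /\
     Rge (Hq #|F| delta) (Rfrac 1 8))
  /\
  (* (2) self-dual four-negacirculant codes, n = 2p, length 4n = 8p *)
  (exists (p : nat -> nat) (a b : nat -> {poly F}) (delta : R),
     (forall k, admissible_prime #|F| (p k)) /\
     (forall k, p k < p k.+1) /\
     (forall k, self_dual (four_negacirc_code (2 * p k) (a k) (b k))) /\
     is_liminf (fun k => Rfrac (min_dist (four_negacirc_code (2 * p k) (a k) (b k)))
                               (4 * (2 * p k))) delta /\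
     Rle 0 delta /\ Rlt delta (Rfrac (#|F| - 1) #|F|) /\
     Rge (Hq #|F| delta) (Rfrac 1 16)).
Proof.
have [f fP] := choice _ Hinf.
(* Iterating the choice function yields a strictly increasing sequence of admissible primes. *)
pose p k := iter k.+1 f 0.
have p_mono k : p k < p k.+1 by have [] := fP (p k).
have p_gt k : k < p k.
  by elim: k => [|k IHk]; [have [] := fP 0 | apply: leq_trans (p_mono k)].
have p_adm k : admissible_prime #|F| (p k) by have [] := fP (iter k f 0).
have p_odd k : odd (p k) by have [_ p3 _ _] := admissible_primeP Hq3 (p_adm k); lia.
have [h hP] := choice _ (fun k => exists_double_negacirc Hq3 (p_adm k)).
have q_ge3 : 3 <= #|F| by lia.
have p2_gt0 k : 0 < 2 * p k by have := p_gt k; lia.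
have chernoff k x := fun x_bnd =>
  ball_card_chernoff (x := x) x_bnd (proj2 (hP k)).
split.
  exists p, h.
  have [k|k x x_bnd|delta [? ? ? ?]] := @family_entropy #|F| 2 p
    (fun k => min_dist (double_negacirc_code (2 * p k) (h k))) q_ge3 isT p_gt p_odd.
  - have [x [xC x_neq0 wt_x]] := double_code_neq0 (negacirc (2 * p k) (h k)) (p2_gt0 k).
    exact: leq_trans (min_dist_leq xC x_neq0) wt_x.
  - have -> : 2 * (2 * p k) = 2 * p k + 2 * p k by lia.
    exact: chernoff.
  exists delta; do !split=> //.
  by move=> k; apply: self_dual_double_code; have [] := hP k.
exists p, h, (fun=> GRing.zero).
have [k|k x x_bnd|delta [? ? ? ?]] := @family_entropy #|F| 4 p
  (fun k => min_dist (four_negacirc_code (2 * p k) (h k) GRing.zero))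
  q_ge3 isT p_gt p_odd.
- rewrite four_negacirc_code0E.
  set M := block_mx _ _ _ _.
  have len_gt0 : 0 < 2 * p k + 2 * p k by have := p2_gt0 k; lia.
  have [x [xC x_neq0 wt_x]] := double_code_neq0 M len_gt0.
  apply: leq_trans (min_dist_leq xC x_neq0) _.
  by apply: leq_trans wt_x _; lia.
- have [hh _] := hP k.
  have le_d := min_dist_double_leq_four hh (p2_gt0 k).
  have ln_x : Rle (ln x) 0 by rewrite -ln_1; apply: Rcomplements.ln_le; case: x_bnd.
  have ln_1x : Rle 0 (ln (1 + (INR #|F| - 1) * x)).
    rewrite -ln_1; apply: Rcomplements.ln_le; first exact: Rlt_0_1.
    have : Rle 1 (INR #|F|) by apply: (le_INR 1); apply/ssrnat.leP; lia.
    by move: x_bnd; nra.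
  have len_le : 2 * p k + 2 * p k <= 4 * (2 * p k) by lia.
  (* The bound for [C_h] carries over: a larger distance lowers the left side, as [ln x <= 0], and
     the doubled length raises the right side. *)
  apply: Rle_trans (Rle_trans _ _ _ _ (chernoff k x x_bnd)) _.
    apply: Rplus_le_compat_l; rewrite !(Rmult_comm _ (ln x)).
    by apply: Rmult_le_compat_neg_l => //; apply/le_INR/ssrnat.leP.
  by apply: Rmult_le_compat_r => //; apply/le_INR/ssrnat.leP.
exists delta; do !split=> //.
move=> k; rewrite four_negacirc_code0E; apply: self_dual_double_code.
by apply: four_block_opp1; have [] := hP k.
Qed.
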